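(* Let $p\in\mathbb{Z}_{\ge0}$, $h\in L^2(\mathbb{R}_+)$ and $f\in\Lambda_p$. Then, for a.e. $t\ge0$, $$\{\mathcal{D}_t,\delta\}\big(h\otimes J_p(f)\big)=h(t)\,J_p(f),$$ that is, $\mathcal{D}_t\big(\delta(h\otimes J_p(f))\big)+\delta\big(h\otimes\mathcal{D}_t(J_p(f))\big)=h(t)\,J_p(f)$.
   Context: $L^2(\mathbb{R}_+)$ is the complex $L^2$ space for Lebesgue measure (inner products linear in the second variable), with complex conjugation $J$. For $h\in L^2(\mathbb{R}_+^n)$ its anti-symmetrization is $\hat h(t_1,\dots,t_n)=\frac1{n!}\sum_{\sigma\in S_n}\mathrm{sgn}(\sigma)h(t_{\sigma(1)},\dots,t_{\sigma(n)})$. $\Lambda_n$ is the space of anti-symmetric functions in $L^2(\mathbb{R}_+^n)$ with inner product $\langle f,g\rangle_{\Lambda_n}=n!\int\overline{f}g\,d\mathbf{x}$, and $\Lambda_0=\mathbb{C}$. $\Gamma_a=\bigoplus_{n\ge0}\Lambda_n$ is the anti-symmetric Fock space (Hilbert direct sum) with vacuum vector $\Omega=1\in\Lambda_0$. For $z\in L^2(\mathbb{R}_+)$, $b^*(z)$ is the bounded operator with $b^*(z)w=\widehat{z\otimes w}$ for $w\in\Lambda_n$, $b(z)$ is its adjoint, and $\Psi(z)=b^*(z)+b(Jz)$. $\mathcal{C}$ is the von Neumann algebra generated by $\{\Psi(z)\}$, and $m(u)=\langle\Omega,u\Omega\rangle$ is a faithful normal tracial state on it; $L^2(\mathcal{C})$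 is the completion of $\mathcal{C}$ in the norm $m(u^*u)^{1/2}$. The map $u\mapsto u\Omega$ extends to a unitary $L^2(\mathcal{C})\to\Gamma_a$, and for $f\in\Lambda_n$, $J_n(f)\in L^2(\mathcal{C})$ denotes the element mapped to $f$ by this unitary; $J_{-1}(\cdot)=0$. For $v_n\in\Lambda_n$, $\mathcal{D}_t(J_n(v_n))=nJ_{n-1}(v_n(t,\cdot))$. For $w_n\in L^2(\mathbb{R}_+^{n+1})$ with $w_n(t,\cdot)\in\Lambda_n$ for a.e. $t$, $\delta(J_n(w_n(t,\cdot)))=J_{n+1}(\hat w_n)$, where $\hat w_n$ is the anti-symmetrization in all $n+1$ variables; both are extended linearly to finite sums. $h\otimes J_p(f)$ is the element $s\mapsto h(s)J_p(f)=J_p(h(s)f)$ of $L^2(\mathbb{R}_+)\otimes L^2(\mathcal{C})$, and $\mathcal{D}_t$ acts on it by $\mathcal{D}_t(h\otimes J_p(f))=h\otimes\mathcal{D}_t(J_p(f))$. *)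

(* Defs.v *)
From HB Require Import structures.
From mathcomp Require Import all_boot all_order all_algebra perm complex.
From mathcomp Require Import all_classical all_reals all_analysis.

Set Implicit Arguments.
Unset Strict Implicit.
Unset Printing Implicit Defensive.

Import Order.TTheory GRing.Theory Num.Theory.
Import numFieldNormedType.Exports.

Local Open Scope classical_set_scope.
Local Open Scope ring_scope.
Local Open Scope complex_scope.

Section HalfLine.
Context (R : realType).

Definition half_line_measurable :
  measurable (`[0%R, +oo[%classic : set (measurableTypeR R)) :=
  measurable_itv _.

(** Functions on [R_+] are modelled by functions on [R] considered modulo this
    measure, which ignores the negative reals. *)
Definition lebesgue_half : set (measurableTypeR R) -> \bar R :=
  mrestr lebesgue_measure half_line_measurable.

HB.instance Definition _ := Measure.on lebesgue_half.

Let lebesgue_half_sigma_finite : sigma_finite setT lebesgue_half.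
Proof.
have /sigma_finiteP[F [FT _ Foo]] := sigma_finiteT (@lebesgue_measure R).
exists F => // n; have [mF Fn] := Foo n; split=> //.
apply: le_lt_trans Fn; apply: le_measure; rewrite ?inE//.
exact: measurableI mF half_line_measurable.
Qed.

HB.instance Definition _ := Measure_isSigmaFinite.Build _ _ _
  lebesgue_half lebesgue_half_sigma_finite.

Section Cons.
Context (n : nat).
Variable m : {sigma_finite_measure set (n.-tuple (measurableTypeR R)) -> \bar R}.

Definition pair_cons (x : measurableTypeR R * n.-tuple (measurableTypeR R)) :
  n.+1.-tuple (measurableTypeR R) := [tuple of x.1 :: x.2].

Lemma measurable_pair_cons : measurable_fun setT pair_cons.
Proof. exact: measurable_cons. Qed.

Definition cons_measure : set (n.+1.-tuple (measurableTypeR R)) -> \bar R :=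
  pushforward (lebesgue_half \x m)%E pair_cons.

Let cons_measure0 : cons_measure set0 = 0%E.
Proof. by rewrite /cons_measure /pushforward preimage_set0 measure0. Qed.

Let cons_measure_ge0 A : (0 <= cons_measure A)%E.
Proof. by rewrite /cons_measure /pushforward; apply: measure_ge0. Qed.

Let cons_measure_sigma_additive : semi_sigma_additive cons_measure.
Proof.
move=> F mF tF mUF; rewrite /cons_measure /pushforward preimage_bigcup.
apply: measure_semi_sigma_additive.
- by move=> k; rewrite -[X in measurable X]setTI; exact: measurable_pair_cons.
- apply/trivIsetP => /= i j _ _ ij; rewrite -preimage_setI.
  by move/trivIsetP : tF => /(_ _ _ _ _ ij) ->//; rewrite preimage_set0.
- rewrite -preimage_bigcup -[X in measurable X]setTI.
  exact: measurable_pair_cons.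
Qed.

HB.instance Definition _ := isMeasure.Build _ _ _
  cons_measure cons_measure0 cons_measure_ge0 cons_measure_sigma_additive.

Let cons_measure_sigma_finite : sigma_finite setT cons_measure.
Proof.
have /sigma_finiteP[F [FT ndF Foo]] := sigma_finiteT lebesgue_half.
have /sigma_finiteP[G [GT ndG Goo]] := sigma_finiteT m.
pose box k : set (n.+1.-tuple (measurableTypeR R)) :=
  [set x | F k (thead x) /\ G k [tuple of behead x]].
have mbox k : measurable (box k).
  have [mF _] := Foo k; have [mG _] := Goo k.
  rewrite -[box k]setTI; apply: measurableI => //; apply: measurableI.
    by rewrite -[X in measurable X]setTI; exact: measurable_tnth.
  by rewrite -[X in measurable X]setTI; exact: measurable_behead.
exists box => [|k].
  apply/esym; rewrite -subTset => x _.
  have [i _ Fi] : (\bigcup_k F k) (thead x) by rewrite -FT.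
  have [j _ Gj] : (\bigcup_k G k) [tuple of behead x] by rewrite -GT.
  exists (maxn i j) => //; split.
    by apply: (subsetPset _ _ (ndF _ _ (leq_maxl i j))).
  by apply: (subsetPset _ _ (ndG _ _ (leq_maxr i j))).
split; first exact: mbox.
have [mF Fk] := Foo k; have [mG Gk] := Goo k.
rewrite /cons_measure /pushforward (_ : pair_cons @^-1` box k = F k `*` G k).
  by rewrite product_measure1E// lte_mul_pinfty// ge0_fin_numE.
have behead_cons (x : R) t : [tuple of behead (pair_cons (x, t))] = t.
  exact: val_inj.
by apply/seteqP; split=> -[a t] /=; rewrite /box /= behead_cons theadE.
Qed.

HB.instance Definition _ := Measure_isSigmaFinite.Build _ _ _
  cons_measure cons_measure_sigma_finite.
End Cons.

(** The [n]-fold product of [lebesgue_half], i.e. Lebesgue measure on [R_+^n]. *)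
Fixpoint lebesgue_half_power (n : nat) :
    {sigma_finite_measure set (n.-tuple (measurableTypeR R)) -> \bar R} :=
  if n is n'.+1 then cons_measure (lebesgue_half_power n')
  else \d_([tuple] : 0.-tuple (measurableTypeR R)).

End HalfLine.

Section FockSpace.
Context (R : realType).
Local Notation C := R[i].
Local Notation R1 := (measurableTypeR R).
Local Notation leb n := (@lebesgue_half_power R n).

Definition square_integrable d (T : measurableType d)
    (mu : {measure set T -> \bar R}) (f : T -> C) : Prop :=
  (fun x => complex.Re (f x)) \in Lfun mu 2%:E /\
  (fun x => complex.Im (f x)) \in Lfun mu 2%:E.

(** Linear in the second variable. *)
Definition L2_inner n (f g : n.-tuple R1 -> C) : C :=
  (\int[leb n]_x complex.Re ((f x)^* * g x)) +i*
  (\int[leb n]_x complex.Im ((f x)^* * g x)).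

Definition permute n (s : 'S_n) (x : n.-tuple R1) : n.-tuple R1 :=
  [tuple tnth x (s i) | i < n].

Definition antisymmetrize n (h : n.-tuple R1 -> C) : n.-tuple R1 -> C :=
  fun x => n`!%:R^-1 * \sum_(s : 'S_n) (-1) ^+ s * h (permute s x).

Definition antisymmetric n (f : n.-tuple R1 -> C) : Prop :=
  forall s : 'S_n,
    {ae leb n, forall x, f (permute s x) = (-1) ^+ s * f x}.

(** Membership in [Lambda_n]; for [n = 0] the measure is the unit mass on the
    only point of [0.-tuple R1], so [Lambda_0] is [C]. *)
Definition Lambda n (f : n.-tuple R1 -> C) : Prop :=
  square_integrable (leb n) f /\ antisymmetric f.

Definition Lambda_inner n (f g : n.-tuple R1 -> C) : C :=
  n`!%:R * L2_inner f g.

Definition Lambda_sqnorm n (f : n.-tuple R1 -> C) : \bar R :=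
  (n`!%:R%:E *
    \int[leb n]_x (complex.Re (f x) ^+ 2 + complex.Im (f x) ^+ 2)%:E)%E.

(** Elements of [Gamma_a] are represented by sequences of functions satisfying
    [in_fock], two sequences being identified when they are related by
    [fock_eq]. *)
Definition fock : Type := forall n, n.-tuple R1 -> C.

Definition in_fock (F : fock) : Prop :=
  (forall n, Lambda (F n)) /\
  (\sum_(0 <= n <oo) Lambda_sqnorm (F n) < +oo)%E.

Definition fock_eq (F G : fock) : Prop :=
  forall n, {ae leb n, forall x, F n x = G n x}.

Definition fock_lin (a : C) (F G : fock) : fock :=
  fun n x => a * F n x + G n x.

Definition fock_inner (F G : fock) : C :=
  limn (fun N => \sum_(n < N) complex.Re (Lambda_inner (F n) (G n))) +i*
  limn (fun N => \sum_(n < N) complex.Im (Lambda_inner (F n) (G n))).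

Definition in_degree n (f : n.-tuple R1 -> C) : fock :=
  dfwith (fun k (_ : k.-tuple R1) => 0 : C) n f.

Definition vacuum : fock := @in_degree 0 (fun=> 1).

Definition operator : Type := fock -> fock.

Definition bounded_operator (u : operator) : Prop :=
  [/\ forall F, in_fock F -> in_fock (u F),
      forall a F G, in_fock F -> in_fock G ->
        fock_eq (u (fock_lin a F G)) (fock_lin a (u F) (u G))
    & exists M : R, forall F, in_fock F ->
        complex.Re (fock_inner (u F) (u F)) <= M * complex.Re (fock_inner F F)].

Definition is_adjoint (u v : operator) : Prop :=
  bounded_operator v /\
  forall F G, in_fock F -> in_fock G ->
    fock_inner (v F) G = fock_inner F (u G).

Definition tensor n (z : R1 -> C) (w : n.-tuple R1 -> C) :
    n.+1.-tuple R1 -> C :=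
  fun x => z (thead x) * w [tuple of behead x].

(** [A] is the operator [b^*(z)]: boundedness and its values on each [Lambda_n]
    determine it up to [fock_eq]. *)
Definition is_creation (z : R1 -> C) (A : operator) : Prop :=
  bounded_operator A /\
  forall n (w : n.-tuple R1 -> C), Lambda w ->
    fock_eq (A (in_degree w)) (in_degree (antisymmetrize (tensor z w))).

Definition is_annihilation (z : R1 -> C) (A : operator) : Prop :=
  exists2 B, is_creation z B & is_adjoint B A.

Definition Psi : set operator :=
  [set u | exists z A B,
     [/\ square_integrable (@lebesgue_half R) z, is_creation z A,
         is_annihilation (fun t => (z t)^*) B
       & u = fun F => fock_lin 1 (A F) (B F)]].

Definition commutant (S : set operator) : set operator :=
  [set u | bounded_operator u /\
     forall s, S s -> forall F, in_fock F -> fock_eq (u (s F)) (s (u F))].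

Definition von_neumann_algebra (M : set operator) : Prop :=
  [/\ M `<=` bounded_operator,
      forall u v, M u -> is_adjoint u v -> M v
    & commutant (commutant M) = M].

Definition generated_von_neumann_algebra (S : set operator) : set operator :=
  \bigcap_(M in [set M | von_neumann_algebra M /\ S `<=` M]) M.

Definition Clifford : set operator := generated_von_neumann_algebra Psi.

Definition vacuum_state (u : operator) : C := fock_inner vacuum (u vacuum).

Section L2Clifford.
Context (H : lmodType C).

(** The forms of the library are linear in their first variable: the inner
    product of [x] and [y], linear in [y], is [dot y x]. *)
Variable dot : {dot H for @conjc R}.

Definition sqnorm (x : H) : R := complex.Re (dot x x).

Definition hilbert_complete : Prop :=
  forall x : nat -> H,
    (forall e : R, 0 < e -> exists N, forall m n,
       (N <= m)%N -> (N <= n)%N -> sqnorm (x m - x n) < e) ->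
    exists l, forall e : R, 0 < e -> exists N, forall n,
       (N <= n)%N -> sqnorm (x n - l) < e.

(** [H], with the map [emb] defined on [Clifford], is the completion of
    [Clifford] for the norm [m(u^* u)^(1/2)]. *)
Definition is_L2_Clifford (emb : operator -> H) : Prop :=
  [/\ hilbert_complete,
      forall a u v, Clifford u -> Clifford v ->
        emb (fun F => fock_lin a (u F) (v F)) = a *: emb u + emb v,
      forall u v, Clifford u -> is_adjoint u v ->
        dot (emb u) (emb u) = vacuum_state (v \o u)
    & forall xi (e : R), 0 < e ->
        exists2 u, Clifford u & sqnorm (xi - emb u) < e].

(** [U] is a unitary from [H] to [Gamma_a] which extends [u |-> u Omega]. *)
Definition is_unitary_extension (emb : operator -> H) (U : H -> fock) : Prop :=
  [/\ forall xi, in_fock (U xi),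
      forall a xi eta, fock_eq (U (a *: xi + eta)) (fock_lin a (U xi) (U eta)),
      forall xi eta, fock_inner (U xi) (U eta) = dot eta xi,
      forall F, in_fock F -> exists xi, fock_eq (U xi) F
    & forall u, Clifford u -> fock_eq (U (emb u)) (u vacuum)].

Variable U : H -> fock.

(** [J_n(f)], the element of [H] sent by [U] to [f] in degree [n]. *)
Definition chaos n (f : n.-tuple R1 -> C) : H :=
  xget 0 [set xi | fock_eq (U xi) (in_degree f)].

Definition slice n (f : n.+1.-tuple R1 -> C) (t : R1) : n.-tuple R1 -> C :=
  fun x => f [tuple of t :: x].

(** The case [n = 0] is the convention [J_{-1} = 0]. *)
Definition chaos_derivative n : (n.-tuple R1 -> C) -> R1 -> H :=
  match n with
  | 0 => fun _ _ => 0
  | m.+1 => fun v t => m.+1%:R *: chaos (slice v t)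
  end.

(** [derivative xi t] is [D_t xi]. It is determined for a.e. [t]: the
    representatives [v n] of the components of [xi] are chosen once, before
    [t]. *)
Definition derivative (xi : H) : R1 -> H :=
  xget (fun=> 0) [set Phi | exists (N : nat) (v : fock),
    [/\ forall n, (n < N)%N -> Lambda (v n),
        xi = \sum_(n < N) chaos (v n)
      & Phi = fun t => \sum_(n < N) chaos_derivative (v n) t]].

(** The divergence of [eta] depends on [eta] only up to a.e. equality; the jointly
    measurable kernels [w n] are determined by [eta] up to a.e. equality. *)
Definition divergence (eta : R1 -> H) : H :=
  xget 0 [set zeta | exists (N : nat) (w : forall n, n.+1.-tuple R1 -> C),
    [/\ forall n, (n < N)%N -> square_integrable (leb n.+1) (w n),
        forall n, (n < N)%N ->
          {ae @lebesgue_half R, forall t, Lambda (slice (w n) t)},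
        {ae @lebesgue_half R, forall t,
          eta t = \sum_(n < N) chaos (slice (w n) t)}
      & zeta = \sum_(n < N) chaos (antisymmetrize (w n))]].

(** The element [h (x) xi] of [L^2(R_+) (x) L^2(Clifford)]. *)
Definition simple_process (h : R1 -> C) (xi : H) : R1 -> H :=
  fun s => h s *: xi.

End L2Clifford.
End FockSpace.

(* Main.v *)
(** Both [D_t (delta (h (x) J_p f))] and [delta (h (x) D_t (J_p f))] are chaoses
    of antisymmetrized tensors.  Grouping the permutations by the value at the
    first index gives, for antisymmetric [f],
    [(p+1) (h (x) f)^(x_0, .., x_p) = sum_j (-1)^j h(x_j) f(x without x_j)].
    At [x_0 = t] the term [j = 0] is [h(t) f], and the others cancel against
    [p (h (x) f(t, .))^(x_1, .., x_p)].

    [derivative] and [divergence] select some representation of their argument.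
    Since the unitary [U] separates the chaoses, two representations have the
    same kernels almost everywhere, on almost every slice for [divergence];
    Tonelli's theorem moves between slices and kernels, and the invariance of
    Lebesgue measure under permutations of the coordinates makes
    antisymmetrization compatible with null sets. *)
Require Import Defs.
From mathcomp Require Import all_boot all_order all_algebra perm complex.
From mathcomp Require Import all_classical all_reals all_analysis.
From mathcomp Require Import measurable_realfun.

Set Implicit Arguments.
Unset Strict Implicit.
Unset Printing Implicit Defensive.

Import Order.TTheory GRing.Theory Num.Theory.
Import numFieldNormedType.Exports.

Local Open Scope classical_set_scope.
Local Open Scope ring_scope.
Local Open Scope complex_scope.

(** * Permutations of [n.+1] indices, grouped by the image of the first index *)

Section LiftPerm.
Context (n : nat).
Implicit Types s : 'S_n.+1.

(** The default [k] of [odflt] is never reached: by injectivity [s] sends [lift ord0 k] to an index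
    other than [s ord0], so [unlift] succeeds. *)
Let unlift_perm_fun s k := odflt k (unlift (s ord0) (s (lift ord0 k))).

Let lift_unlift_perm_fun s k :
  lift (s ord0) (unlift_perm_fun s k) = s (lift ord0 k).
Proof.
rewrite /unlift_perm_fun; have := neq_lift ord0 k.
by rewrite -(can_eq (permK s)) => /unlift_some[] ? ? ->.
Qed.

Let unlift_perm_inj s : injective (unlift_perm_fun s).
Proof.
move=> k l kl; apply: (@lift_inj _ ord0); apply: (@perm_inj _ s).
by rewrite -!lift_unlift_perm_fun kl.
Qed.

Definition unlift_perm s : 'S_n := perm (@unlift_perm_inj s).

Lemma unlift_permK s : lift_perm ord0 (s ord0) (unlift_perm s) = s.
Proof.
apply/permP => k; case: (unliftP ord0 k) => [l ->|->]; last exact: lift_perm_id.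
by rewrite lift_perm_lift permE lift_unlift_perm_fun.
Qed.

Lemma unlift_perm_lift (j : 'I_n.+1) (t : 'S_n) :
  unlift_perm (lift_perm ord0 j t) = t.
Proof.
apply/permP => k; apply: (@lift_inj _ j).
rewrite [unlift_perm _ _]permE -[RHS](lift_perm_lift ord0).
by rewrite -lift_unlift_perm_fun lift_perm_id.
Qed.

(** A permutation amounts to the image [j] of the first index together with the permutation
    [unlift_perm] that it induces on the others. This is the combinatorial part of a Laplace
    expansion along the first index. *)
Lemma sum_lift_perm (V : nmodType) (F : 'S_n.+1 -> V) :
  \sum_s F s = \sum_j \sum_t F (lift_perm ord0 j t).
Proof.
rewrite pair_bigA/= (reindex (fun p => lift_perm ord0 p.1 p.2))//=.
apply: onW_bij; exists (fun s => (s ord0, unlift_perm s)).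
  by move=> [j t] /=; rewrite lift_perm_id unlift_perm_lift.
by move=> s /=; exact: unlift_permK.
Qed.

End LiftPerm.

(** * Square-integrable functions and permutations of the coordinates *)

Section RealL2.
Context d (T : measurableType d) (R : realType).
Context (mu : {measure set T -> \bar R}).
Implicit Types f g : T -> R.

(** This replaces the [L^2] norm by the integral of the square, a form to which Tonelli's theorem
    and changes of variables apply directly. *)
Lemma Lfun2P f : f \in Lfun mu 2%:E <->
  measurable_fun setT f /\ (\int[mu]_x (f x ^+ 2)%:E < +oo)%E.
Proof.
split=> [f2|[mf f2]].
  have := f2; rewrite inE => /andP[/set_mem /= mf _]; split; first exact: mf.
  have /integrableP[_] := Lfun2_integrable_sqr f2.
  by under eq_integral => x _ do rewrite /= ger0_norm ?sqr_ge0//.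
rewrite inE; apply/andP; split; rewrite inE//=.
rewrite /finite_norm unlock /Lnorm /= .
rewrite poweR_lty//.
by under eq_integral => x _ do
  rewrite powR_mulrn ?normr_ge0 // -normrX ger0_norm ?sqr_ge0//.
Qed.

Lemma Lfun2D f g : f \in Lfun mu 2%:E -> g \in Lfun mu 2%:E ->
  (fun x => f x + g x) \in Lfun mu 2%:E.
Proof.
have p1 : (1 <= (2%:R : R)%:E)%E by rewrite lee_fin ler1n.
by have [_ +] := @Lfun_addr_closed _ _ _ mu _ p1; apply.
Qed.

Lemma Lfun2Z a f : f \in Lfun mu 2%:E -> (fun x => a * f x) \in Lfun mu 2%:E.
Proof.
move=> f2; rewrite (_ : (fun _ => _) = a \o* f); last first.
  by apply/funext => x /=; rewrite mulrC.
by apply: Lfun_scale => //; rewrite ler1n.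
Qed.

End RealL2.

(** * The product measure: slices, null sets and coordinate permutations *)

Section HalfLinePower.
Context (R : realType).
Local Notation R1 := (measurableTypeR R).
Local Notation leb1 := (@lebesgue_half R).
Local Notation leb n := (@lebesgue_half_power R n).

Lemma measurable_cons_left n (t : R1) :
  measurable_fun setT (fun x : n.-tuple R1 => [tuple of t :: x]).
Proof. exact: measurable_cons. Qed.

Lemma measurable_permute n (s : 'S_n) : measurable_fun setT (@permute R n s).
Proof.
apply/measurable_fun_tnthP => i.
rewrite (_ : _ \o _ = (@tnth n R1)^~ (s i)); first exact: measurable_tnth.
by apply/funext => x /=; rewrite tnth_mktuple.
Qed.

Lemma xsection_pair_cons n (A : set (n.+1.-tuple R1)) t :
  xsection (@pair_cons R n @^-1` A) t =
  [set x : n.-tuple R1 | A [tuple of t :: x]].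
Proof. by apply/seteqP; split=> x /=; rewrite /xsection /= inE. Qed.

Lemma measurable_preimage_pair_cons n (A : set (n.+1.-tuple R1)) :
  measurable A -> measurable (@pair_cons R n @^-1` A).
Proof.
by move=> mA; rewrite -[X in measurable X]setTI; exact: measurable_pair_cons.
Qed.

Lemma lebesgue_half_powerS n (A : set (n.+1.-tuple R1)) :
  leb n.+1 A =
  (\int[leb1]_t leb n [set x : n.-tuple R1 | A [tuple of t :: x]])%E.
Proof.
rewrite /= /cons_measure /pushforward /product_measure1.
by apply: eq_integral => t _ /=; rewrite xsection_pair_cons.
Qed.

Lemma measurable_cons_section n (A : set (n.+1.-tuple R1)) : measurable A ->
  measurable_fun setT
    (fun t => leb n [set x : n.-tuple R1 | A [tuple of t :: x]]).
Proof.
move=> /measurable_preimage_pair_cons/(measurable_fun_xsection (leb n)).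
by apply: eq_measurable_fun => t _ /=; rewrite xsection_pair_cons.
Qed.

Lemma integral_lebesgue_half_powerS n (f : n.+1.-tuple R1 -> \bar R) :
  measurable_fun setT f -> (forall x, 0 <= f x)%E ->
  (\int[leb n.+1]_x f x = \int[leb1]_t \int[leb n]_x f [tuple of t :: x])%E.
Proof.
move=> mf f0.
have mcons := @measurable_pair_cons R n.
rewrite (@ge0_integral_pushforward _ _ _ _ _ _ mcons (leb1 \x leb n)%E)//.
rewrite preimage_setT fubini_tonelli1// => [|x]; last exact: f0.
by apply: measurableT_comp => //; exact: measurable_pair_cons.
Qed.

(** The measures of the slices of a null set form a nonnegative function with integral zero, which
    therefore vanishes almost everywhere. *)
Lemma ae_cons n (P : n.+1.-tuple R1 -> Prop) : {ae leb n.+1, forall x, P x} ->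
  {ae leb1, forall t, {ae leb n, forall x : n.-tuple R1, P [tuple of t :: x]}}.
Proof.
case=> A [mA A0 PA]; rewrite lebesgue_half_powerS in A0.
have mf := measurable_cons_section mA.
have /(ae_eq_integral_abs _ measurableT mf) :
    (\int[leb1]_t `|leb n [set x : n.-tuple R1 | A [tuple of t :: x]]| = 0)%E.
  by rewrite -[RHS]A0; apply: eq_integral => t _; rewrite gee0_abs.
apply: filterS => t /(_ I) At.
exists [set x : n.-tuple R1 | A [tuple of t :: x]]; split => //.
  by rewrite -[X in measurable X]setTI; exact: measurable_cons_left.
by move=> x /= Px; exact: PA.
Qed.

(** Measurability of [P] lets the measure of its complement be computed as the integral of the
    measures of the slices, almost all of which are zero. *)
Lemma ae_of_ae_cons n (P : n.+1.-tuple R1 -> Prop) : measurable [set x | P x] ->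
  {ae leb1, forall t,
    {ae leb n, forall x : n.-tuple R1, P [tuple of t :: x]}} ->
  {ae leb n.+1, forall x, P x}.
Proof.
move=> mP aeP; apply/negligibleP; first exact: measurableC.
apply: etrans (lebesgue_half_powerS _) _.
rewrite -[RHS](@integral0 _ _ _ leb1 setT).
apply: ae_eq_integral => //.
  by apply: (@measurable_cons_section n (~` [set x | P x])); exact: measurableC.
move: aeP; apply: filterS => t aet _.
have mt : measurable [set x : n.-tuple R1 | ~ P [tuple of t :: x]].
  rewrite -[X in measurable X]setTI.
  exact: (@measurable_cons_left n t measurableT _ (measurableC mP)).
exact/(negligibleP _ mt).
Qed.

Lemma permuteM n (s t : 'S_n) x :
  @permute R n s (permute t x) = permute (s * t)%g x.
Proof. by apply: eq_from_tnth => i; rewrite !tnth_mktuple permM. Qed.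

Lemma permute_cons n (s : 'S_n) (t : R1) (x : n.-tuple R1) :
  permute (lift_perm ord0 ord0 s) [tuple of t :: x] =
  [tuple of t :: permute s x].
Proof.
apply: eq_from_tnth => i; rewrite tnth_mktuple.
case: (unliftP ord0 i) => [j ->|->]; last by rewrite lift_perm_id !tnth0.
by rewrite lift_perm_lift !tnthS tnth_mktuple.
Qed.

Lemma permute_swap n (a b : R1) (x : n.-tuple R1) :
  permute (tperm ord0 (lift ord0 ord0)) [tuple of a :: [tuple of b :: x]] =
  [tuple of b :: [tuple of a :: x]].
Proof.
apply: eq_from_tnth => i; rewrite tnth_mktuple.
case: (unliftP ord0 i) => [j ->|->]; last by rewrite tpermL tnthS !tnth0.
case: (unliftP ord0 j) => [k ->|->]; last by rewrite tpermR tnthS !tnth0.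
by rewrite tpermD// !tnthS.
Qed.

Definition permute_invariant n (s : 'S_n) := forall A : set (n.-tuple R1),
  measurable A -> leb n [set x | A (permute s x)] = leb n A.

Lemma permute_invariantM n (s t : 'S_n) :
  permute_invariant s -> permute_invariant t -> permute_invariant (s * t)%g.
Proof.
move=> sI tI A mA; under eq_set => x do rewrite -permuteM.
rewrite (tI [set y | A (permute s y)]) ?sI//.
by rewrite -[X in measurable X]setTI; exact: measurable_permute.
Qed.

(** The first coordinate stays fixed, so each slice along it is merely permuted by [s]. *)
Lemma permute_invariant_lift n (s : 'S_n) :
  permute_invariant s -> permute_invariant (lift_perm ord0 ord0 s).
Proof.
move=> sI A mA; rewrite !lebesgue_half_powerS.
apply: eq_integral => t _.
under eq_set => x do rewrite /= permute_cons.
rewrite (sI [set x : n.-tuple R1 | A [tuple of t :: x]])//.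
by rewrite -[X in measurable X]setTI; exact: measurable_cons_left.
Qed.

(** Exchanging the first two coordinates exchanges the two outer integrals, which is Tonelli's
    theorem for the function [phi] measuring the slices in both coordinates. *)
Lemma permute_invariant_swap n :
  permute_invariant (tperm ord0 (lift ord0 ord0) : 'S_n.+2).
Proof.
move=> A mA; rewrite !lebesgue_half_powerS.
pose phi (p : R1 * R1) :=
  leb n [set x : n.-tuple R1 | A [tuple of p.1 :: [tuple of p.2 :: x]]].
have mphi : measurable_fun setT phi.
  pose B := [set q : (R1 * R1) * n.-tuple R1 |
    A [tuple of q.1.1 :: [tuple of q.1.2 :: q.2]]].
  have mB : measurable B.
    rewrite -[X in measurable X]setTI.
    have : measurable_fun setT (fun q : (R1 * R1) * n.-tuple R1 =>
        [tuple of q.1.1 :: [tuple of q.1.2 :: q.2]]).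
      apply: measurable_cons; last apply: measurable_cons => //.
        exact: measurableT_comp.
      exact: measurableT_comp.
    exact.
  have := measurable_fun_xsection (leb n) mB.
  apply: eq_measurable_fun => p _; congr (leb n _).
  by apply/seteqP; split=> x; rewrite /xsection/= inE.
rewrite [RHS](_ : _ = \int[leb1]_a \int[leb1]_b phi (a, b))%E; last first.
  by apply: eq_integral => a _; rewrite lebesgue_half_powerS.
have phi0 p : (0 <= phi p)%E by exact: measure_ge0.
rewrite (fubini_tonelli phi mphi phi0).
apply: eq_integral => a _; rewrite lebesgue_half_powerS.
apply: eq_integral => b _; congr (leb n _).
by apply/seteqP; split=> x /=; rewrite permute_swap.
Qed.

(** Induction on [n]: permutations fixing the first index come from the induction hypothesis, and
    together with the swap of the first two indices they generate all the others. *)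
Lemma lebesgue_half_power_permute n (s : 'S_n) : permute_invariant s.
Proof.
elim: n s => [|n IHn] s.
  by move=> A mA; congr (leb 0 _); apply/seteqP; split=> x /=;
    rewrite (tuple0 (permute s x)) (tuple0 x).
have inv_fix0 (u : 'S_n.+1) : u ord0 = ord0 -> permute_invariant u.
  move=> u0; rewrite -(unlift_permK u) u0; exact: permute_invariant_lift.
have [/inv_fix0//|] := eqVneq (s ord0) ord0.
case: (unliftP ord0 (s ord0)) => [k s0 _|->]; last by rewrite eqxx.
case: n IHn s inv_fix0 k s0 => [|n] IHn s inv_fix0 k s0; first by case: k {s0}.
pose v : 'S_n.+2 := lift_perm ord0 ord0 (tperm ord0 k).
pose tau : 'S_n.+2 := tperm ord0 (lift ord0 ord0).
(* Products act from left to right. After [s] sends the first index to [lift ord0 k], [v] moves it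
   to the second index and [tau] back to the first, so [s * v * tau] fixes the first index, as does
   [v]. Since [v] and [tau] are involutions, the product is [s]. *)
have -> : s = ((s * v * tau) * (tau * v))%g.
  rewrite -!mulgA (mulgA tau tau) tperm2 mul1g /v lift_permM tperm2.
  by rewrite lift_perm1 mulg1.
apply: permute_invariantM.
  by apply: inv_fix0; rewrite !permM s0 lift_perm_lift tpermR tpermR.
apply: permute_invariantM; first exact: permute_invariant_swap.
by apply: inv_fix0; rewrite lift_perm_id.
Qed.

Lemma ae_permute n (s : 'S_n) (P : n.-tuple R1 -> Prop) :
  {ae leb n, forall x, P x} -> {ae leb n, forall x, P (permute s x)}.
Proof.
case=> A [mA A0 PA]; exists [set x | A (permute s x)]; split.
- by rewrite -[X in measurable X]setTI; exact: measurable_permute.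
- by rewrite lebesgue_half_power_permute.
- by move=> x /= Px; exact: PA.
Qed.

Lemma Lfun2_permute n (s : 'S_n) (f : n.-tuple R1 -> R) :
  f \in Lfun (leb n) 2%:E -> (fun x => f (permute s x)) \in Lfun (leb n) 2%:E.
Proof.
have mperm := @measurable_permute n s.
move=> /Lfun2P[mf f2]; apply/Lfun2P; split; first exact: measurableT_comp.
pose F x := (f x ^+ 2)%:E.
have mF : measurable_fun setT F by apply/measurable_EFinP/measurable_funX.
have F0 x : (0 <= F x)%E by rewrite lee_fin sqr_ge0.
(* By invariance the pushforward of [leb n] along [permute s] is [leb n] itself, so the integral of
   the square does not change. *)
rewrite -[X in (X < _)%E]
  (@ge0_integral_pushforward _ _ _ _ _ _ mperm (leb n) setT F)//.
rewrite (eq_measure_integral (leb n))// => A mA _.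
exact: lebesgue_half_power_permute.
Qed.

(** Tonelli factors the integral of the square into the product of the two finite integrals. *)
Lemma Lfun2_tensor n (f : R1 -> R) (g : n.-tuple R1 -> R) :
  f \in Lfun leb1 2%:E -> g \in Lfun (leb n) 2%:E ->
  (fun x => f (thead x) * g [tuple of behead x]) \in Lfun (leb n.+1) 2%:E.
Proof.
move=> /Lfun2P[mf f2] /Lfun2P[mg g2]; apply/Lfun2P.
have mfg : measurable_fun setT
    (fun x : n.+1.-tuple R1 => f (thead x) * g [tuple of behead x]).
  apply: measurable_funM.
    by apply: measurableT_comp => //; exact: measurable_tnth.
  by apply: measurableT_comp => //; exact: measurable_behead.
split=> //; rewrite integral_lebesgue_half_powerS; first last.
- by move=> x; rewrite lee_fin sqr_ge0.
- exact/measurable_EFinP/measurable_funX.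
have mg2 : measurable_fun setT (fun x => (g x ^+ 2)%:E).
  exact/measurable_EFinP/measurable_funX.
have mf2 : measurable_fun setT (fun x => (f x ^+ 2)%:E).
  exact/measurable_EFinP/measurable_funX.
have behead_cons t (x : n.-tuple R1) : [tuple of behead [tuple of t :: x]] = x.
  exact: val_inj.
under eq_integral => t _.
  under eq_integral => x _ do rewrite theadE behead_cons exprMn EFinM.
  rewrite ge0_integralZl//; last 2 first.
  - by move=> x _; rewrite lee_fin sqr_ge0.
  - by rewrite lee_fin sqr_ge0.
  over.
rewrite /= ge0_integralZr//.
- by rewrite lte_mul_pinfty// ?ge0_fin_numE//; apply: integral_ge0 => x _;
    rewrite lee_fin sqr_ge0.
- by move=> x _; rewrite lee_fin sqr_ge0.
- by apply: integral_ge0 => x _; rewrite lee_fin sqr_ge0.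
Qed.

(** The squared norms of the slices have a finite integral in [t], hence are finite for almost every
    [t]. *)
Lemma ae_Lfun2_cons n (f : n.+1.-tuple R1 -> R) :
  f \in Lfun (leb n.+1) 2%:E ->
  {ae leb1, forall t, (fun x : n.-tuple R1 => f [tuple of t :: x])
    \in Lfun (leb n) 2%:E}.
Proof.
move=> /Lfun2P[mf].
have mf2 : measurable_fun setT (fun x => (f x ^+ 2)%:E).
  exact/measurable_EFinP/measurable_funX.
have f20 (x : n.+1.-tuple R1) : (0 <= (f x ^+ 2)%:E)%E.
  by rewrite lee_fin sqr_ge0.
rewrite integral_lebesgue_half_powerS// => foo.
have : leb1.-integrable setT
    (fun t => \int[leb n]_x (f [tuple of t :: x] ^+ 2)%:E)%E.
  apply/integrableP; split.
    have mF := measurableT_comp mf2 (@measurable_pair_cons R n).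
    apply: (measurable_fun_fubini_tonelli_F (m2 := leb n) _ mF).
    by move=> p; exact: f20.
  by under eq_integral => t _ do rewrite gee0_abs ?integral_ge0//.
move=> /(integrable_ae measurableT); apply: filterS => t /(_ I).
rewrite ge0_fin_numE ?integral_ge0// => ft; apply/Lfun2P; split=> //.
by apply: measurableT_comp => //; exact: measurable_cons_left.
Qed.

End HalfLinePower.

(** * Complex-valued square-integrable functions *)

Section SquareIntegrable.
Context d (T : measurableType d) (R : realType).
Context (mu : {measure set T -> \bar R}).
Local Notation C := R[i].
Implicit Types (F G : T -> C).

Lemma square_integrable0 : square_integrable mu (fun=> 0).
Proof.
by split; apply/Lfun2P; split=> //=; rewrite integral0_eq// => x _;
  rewrite expr0n.
Qed.

Lemma square_integrableD F G : square_integrable mu F ->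
  square_integrable mu G -> square_integrable mu (fun x => F x + G x).
Proof.
move=> [rF iF] [rG iG]; split.
  rewrite (_ : (fun _ => _) = fun x => complex.Re (F x) + complex.Re (G x)).
    exact: Lfun2D.
  by apply/funext => x; case: (F x); case: (G x).
rewrite (_ : (fun _ => _) = fun x => complex.Im (F x) + complex.Im (G x)).
  exact: Lfun2D.
by apply/funext => x; case: (F x); case: (G x).
Qed.

Lemma square_integrableZ a F : square_integrable mu F ->
  square_integrable mu (fun x => a * F x).
Proof.
move=> [rF iF]; split.
  rewrite (_ : (fun _ => _) = fun x =>
      complex.Re a * complex.Re (F x) + (- complex.Im a) * complex.Im (F x)).
    by apply: Lfun2D; exact: Lfun2Z.
  by apply/funext => x; case: (F x) => u v; case: a => b c /=; rewrite mulNr.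
rewrite (_ : (fun _ => _) = fun x =>
    complex.Re a * complex.Im (F x) + complex.Im a * complex.Re (F x)).
  by apply: Lfun2D; exact: Lfun2Z.
by apply/funext => x; case: (F x) => u v; case: a => b c.
Qed.

Lemma square_integrable_sum (I : Type) (r : seq I) (F : I -> T -> C) :
  (forall i, square_integrable mu (F i)) ->
  square_integrable mu (fun x => \sum_(i <- r) F i x).
Proof.
move=> FI; elim: r => [|i r IHr].
  under eq_fun do rewrite big_nil; exact: square_integrable0.
by under eq_fun do rewrite big_cons; exact: square_integrableD.
Qed.

(** Supplies the measurability needed to pass from almost all slices to the whole space in
    [ae_of_ae_cons]. *)
Lemma measurable_square_integrable_eq F G : square_integrable mu F ->
  square_integrable mu G -> measurable [set x | F x = G x].
Proof.
move=> [/Lfun2P[rF _] /Lfun2P[iF _]] [/Lfun2P[rG _] /Lfun2P[iG _]].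
rewrite (_ : [set _ | _] =
    [set x | (complex.Re (F x))%:E = (complex.Re (G x))%:E] `&`
    [set x | (complex.Im (F x))%:E = (complex.Im (G x))%:E]); last first.
  apply/seteqP; split=> x /=; first by move=> ->.
  by case: (F x) (G x) => a b [c e] /= [[->] [->]].
apply: measurableI; rewrite -[X in measurable X]setTI.
  by apply: measurable_eqe => //; exact/measurable_EFinP.
by apply: measurable_eqe => //; exact/measurable_EFinP.
Qed.

End SquareIntegrable.

(** * Antisymmetrization *)

Section Antisymmetry.
Context (R : realType).
Local Notation C := R[i].
Local Notation R1 := (measurableTypeR R).
Local Notation leb1 := (@lebesgue_half R).
Local Notation leb n := (@lebesgue_half_power R n).

Lemma square_integrable_tensor n (h : R1 -> C) (f : n.-tuple R1 -> C) :
  square_integrable leb1 h -> square_integrable (leb n) f ->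
  square_integrable (leb n.+1) (tensor h f).
Proof.
move=> [rh ih] [rf jf]; split.
  rewrite (_ : (fun _ => _) = fun x =>
      complex.Re (h (thead x)) * complex.Re (f [tuple of behead x]) +
      (- 1) * (complex.Im (h (thead x)) * complex.Im (f [tuple of behead x]))).
    exact: (Lfun2D (Lfun2_tensor rh rf) (Lfun2Z _ (Lfun2_tensor ih jf))).
  apply/funext => x; rewrite /tensor mulN1r.
  by case: (h _) => a b; case: (f _).
rewrite (_ : (fun _ => _) = fun x =>
    complex.Re (h (thead x)) * complex.Im (f [tuple of behead x]) +
    complex.Im (h (thead x)) * complex.Re (f [tuple of behead x])).
  exact: (Lfun2D (Lfun2_tensor rh jf) (Lfun2_tensor ih rf)).
by apply/funext => x; rewrite /tensor; case: (h _) => a b; case: (f _).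
Qed.

Lemma ae_square_integrable_slice n (f : n.+1.-tuple R1 -> C) :
  square_integrable (leb n.+1) f ->
  {ae leb1, forall t, square_integrable (leb n) (slice f t)}.
Proof.
by move=> [/ae_Lfun2_cons + /ae_Lfun2_cons]; apply: filterS2 => t rf jf.
Qed.

Lemma ae_slice_inj n (f g : n.+1.-tuple R1 -> C) :
  square_integrable (leb n.+1) f -> square_integrable (leb n.+1) g ->
  {ae leb1, forall t, {ae leb n, forall x, slice f t x = slice g t x}} ->
  {ae leb n.+1, forall x, f x = g x}.
Proof.
move=> f2 g2; apply: ae_of_ae_cons.
exact: measurable_square_integrable_eq f2 g2.
Qed.

(** Holds at every point, unlike [antisymmetric]; each element of [Lambda_n] has
    such a representative, its antisymmetrization. *)
Definition strictly_antisymmetric n (f : n.-tuple R1 -> C) :=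
  forall (s : 'S_n) x, f (permute s x) = (-1) ^+ s * f x.

Lemma antisymmetrize_strict n (h : n.-tuple R1 -> C) :
  strictly_antisymmetric (antisymmetrize h).
Proof.
move=> s x; rewrite /antisymmetrize mulrCA; congr (_ * _).
(* Replacing [t] by [t * s^-1] cancels the inner [permute s]; what remains is the sign of [s^-1],
   which is that of [s]. *)
rewrite (reindex_inj (mulIg s^-1%g)) mulr_sumr; apply: eq_bigr => t _.
rewrite permuteM -mulgA mulVg mulg1 odd_permM odd_permV signr_addb mulrA.
by rewrite [(-1) ^+ s * _]mulrC.
Qed.

Lemma square_integrable_antisymmetrize n (h : n.-tuple R1 -> C) :
  square_integrable (leb n) h -> square_integrable (leb n) (antisymmetrize h).
Proof.
move=> [rh ih]; apply/square_integrableZ/square_integrable_sum => s.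
apply: square_integrableZ.
by split; [apply: Lfun2_permute rh|apply: Lfun2_permute ih].
Qed.

Lemma strictly_antisymmetric_Lambda n (f : n.-tuple R1 -> C) :
  square_integrable (leb n) f -> strictly_antisymmetric f -> Lambda f.
Proof. by move=> f2 fS; split=> // s; exact/aeW/fS. Qed.

Lemma Lambda_antisymmetrize n (h : n.-tuple R1 -> C) :
  square_integrable (leb n) h -> Lambda (antisymmetrize h).
Proof.
move=> h2; apply: strictly_antisymmetric_Lambda (@antisymmetrize_strict n h).
exact: square_integrable_antisymmetrize.
Qed.

Lemma ae_antisymmetrize_id n (f : n.-tuple R1 -> C) : Lambda f ->
  {ae leb n, forall x, f x = antisymmetrize f x}.
Proof.
move=> [_ fA]; have : {ae leb n, forall x, forall s : 'S_n,
    f (permute s x) = (-1) ^+ s * f x} by exact: filter_forall.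
apply: filterS => x fx; rewrite /antisymmetrize.
under eq_bigr => s _ do rewrite fx mulrA -signr_addb addbb mul1r.
rewrite sumr_const card_Sn -[f x *+ _]mulr_natl mulKf//.
Qed.

(** The antisymmetrization evaluates its argument at all permuted points; by invariance of the
    measure, the finitely many permuted exceptional sets are still null. *)
Lemma ae_eq_antisymmetrize n (f g : n.-tuple R1 -> C) :
  {ae leb n, forall x, f x = g x} ->
  {ae leb n, forall x, antisymmetrize f x = antisymmetrize g x}.
Proof.
move=> fg; have : {ae leb n, forall x, forall s : 'S_n,
    f (permute s x) = g (permute s x)}.
  by apply: filter_forall => s; exact: (ae_permute s fg).
apply: filterS => x fgx; rewrite /antisymmetrize; congr (_ * _).
by apply: eq_bigr => s _; rewrite fgx.
Qed.

Lemma antisymmetrize0 n :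
  antisymmetrize (fun _ : n.-tuple R1 => 0 : C) = fun=> 0.
Proof.
apply/funext => x; rewrite /antisymmetrize big1 ?mulr0// => s _.
by rewrite mulr0.
Qed.

Lemma Lambda0 n : Lambda (fun _ : n.-tuple R1 => 0 : C).
Proof.
split=> [|s]; first exact: square_integrable0.
by apply: aeW => x; rewrite mulr0.
Qed.

Lemma Lambda_lin n a (f g : n.-tuple R1 -> C) : Lambda f -> Lambda g ->
  Lambda (fun x => a * f x + g x).
Proof.
move=> [f2 fA] [g2 gA]; split=> [|s].
  by apply: square_integrableD => //; exact: square_integrableZ.
by move: (fA s) (gA s); apply: filterS2 => x -> ->; rewrite mulrCA mulrDr.
Qed.

(** Permuting the coordinates of a slice is permuting those of [f] with the first index fixed, and
    this extension keeps the sign. *)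
Lemma ae_Lambda_slice n (f : n.+1.-tuple R1 -> C) : Lambda f ->
  {ae leb1, forall t, Lambda (slice f t)}.
Proof.
move=> [/ae_square_integrable_slice f2 fA].
have : {ae leb1, forall t, Defs.antisymmetric (slice f t)}.
  apply: filter_forall => s.
  have := ae_cons (fA (lift_perm ord0 ord0 s)).
  apply: filterS => t; apply: filterS => x.
  by rewrite permute_cons odd_lift_perm.
by move: f2; apply: filterS2.
Qed.

Lemma strictly_antisymmetric_slice n (f : n.+1.-tuple R1 -> C) t :
  strictly_antisymmetric f -> strictly_antisymmetric (slice f t).
Proof. by move=> fS s x; rewrite /slice -permute_cons fS odd_lift_perm. Qed.

Definition omit n (j : 'I_n.+1) (x : n.+1.-tuple R1) : n.-tuple R1 :=
  [tuple tnth x (lift j i) | i < n].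

Lemma antisymmetrize_tensor p (h : R1 -> C) (f : p.-tuple R1 -> C) x :
  strictly_antisymmetric f ->
  p.+1%:R * antisymmetrize (tensor h f) x =
  \sum_(j < p.+1) (-1) ^+ j * (h (tnth x j) * f (omit j x)).
Proof.
move=> fS; rewrite /antisymmetrize sum_lift_perm mulrA mulr_sumr.
apply: eq_bigr => j _.
rewrite (eq_bigr (fun=> (-1) ^+ j * (h (tnth x j) * f (omit j x)))); last first.
  move=> t _; rewrite /tensor odd_lift_perm /= signr_addb signr_odd.
  have -> : thead (permute (lift_perm ord0 j t) x) = tnth x j.
    by rewrite /thead tnth_mktuple lift_perm_id.
  have -> : [tuple of behead (permute (lift_perm ord0 j t) x)] =
      permute t (omit j x).
    apply: eq_from_tnth => i.
    rewrite tnth_behead (_ : inord i.+1 = lift ord0 i); last first.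
      by apply: val_inj; rewrite /= inordK// ltnS.
    by rewrite !tnth_mktuple lift_perm_lift.
  (* The sign of [t] occurs twice, once from the permutation and once from the antisymmetry of [f].
     It cancels, so for fixed [j] all [p!] terms are equal. *)
  rewrite fS; set e := (-1) ^+ t.
  have e1 : e * e = 1 by rewrite /e -signr_addb addbb.
  by rewrite -mulrA [h _ * _]mulrCA [e * (e * _)]mulrA e1 mul1r.
have factK : p.+1%:R / p.+1`!%:R * p`!%:R = 1 :> C.
  by rewrite factS natrM mulrAC -natrM mulfV// pnatr_eq0 -lt0n -factS fact_gt0.
by rewrite sumr_const card_Sn -[(_ * _) *+ _]mulr_natl !mulrA factK mul1r.
Qed.

Lemma antisymmetrize_tensor_cons p (h : R1 -> C) (f : p.+1.-tuple R1 -> C)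
    (t : R1) (y : p.+1.-tuple R1) :
  strictly_antisymmetric f ->
  p.+2%:R * antisymmetrize (tensor h f) [tuple of t :: y] +
  p.+1%:R * antisymmetrize (tensor h (slice f t)) y = h t * f y.
Proof.
move=> fS; rewrite antisymmetrize_tensor//.
rewrite antisymmetrize_tensor; last exact: strictly_antisymmetric_slice.
rewrite big_ord_recl tnth0 expr0 mul1r.
have -> : omit ord0 [tuple of t :: y] = y.
  by apply: eq_from_tnth => i; rewrite tnth_mktuple tnthS.
rewrite -addrA -big_split/= big1 ?addr0// => i _.
(* Omitting entry [i+1] of [t :: y] keeps [t] in front and omits entry [i] of [y]. The same term
   thus occurs in both expansions, with the opposite signs [(-1)^(i+1)] and [(-1)^i]. *)
rewrite tnthS; have -> : omit (lift ord0 i) [tuple of t :: y] =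
    [tuple of t :: omit i y].
  apply: eq_from_tnth => k; rewrite tnth_mktuple.
  case: (unliftP ord0 k) => [l ->|->].
    rewrite tnthS tnth_mktuple -[RHS](tnthS t); congr tnth.
    by apply: val_inj; rewrite /= /bump !add1n ltnS addnS.
  by rewrite tnth0 -[RHS](tnth0 t y); congr tnth; exact: val_inj.
by rewrite /slice exprS mulN1r mulNr addNr.
Qed.

(** Degree zero is separate: [f] has no slices, and the second term of the anticommutator vanishes
    by the convention [J_{-1} = 0]. *)
Lemma antisymmetrize_tensor_cons0 (h : R1 -> C) (f : 0.-tuple R1 -> C)
    (t : R1) (y : 0.-tuple R1) :
  strictly_antisymmetric f ->
  antisymmetrize (tensor h f) [tuple of t :: y] = h t * f y.
Proof.
move=> fS; have := antisymmetrize_tensor h [tuple of t :: y] fS.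
rewrite mul1r => ->.
rewrite big_ord_recl big_ord0 addr0 tnth0 expr0 mul1r.
by rewrite [omit _ _]tuple0 [y]tuple0.
Qed.

End Antisymmetry.

(** Evaluates a finite expansion whose kernels vanish outside degree [n]. The sum is zero when the
    cutoff [N] excludes that degree. *)
Lemma sum_dfwith (V : zmodType) (T : nat -> Type) (z : forall k, T k)
    (G : forall k, T k -> V) n (x : T n) N :
  (forall k, G k (z k) = 0) ->
  \sum_(k < N) G k (dfwith z n x k) = if (n < N)%N then G n x else 0.
Proof.
move=> G0; case: ifPn => [nN|]; last first.
  rewrite -leqNgt => Nn; rewrite big1// => k _; rewrite dfwithout// gtn_eqF//.
  exact: leq_trans Nn.
rewrite (bigD1 (Ordinal nN))//= dfwithin big1 ?addr0// => k kn.
rewrite dfwithout//; apply: contra_neq kn => nk; exact/val_inj.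
Qed.

(** * Chaos expansion, derivative and divergence *)

Section Fock.
Context (R : realType).
Local Notation C := R[i].
Local Notation R1 := (measurableTypeR R).
Local Notation leb1 := (@lebesgue_half R).
Local Notation leb n := (@lebesgue_half_power R n).

Lemma in_degree_in n (f : n.-tuple R1 -> C) : @in_degree _ _ f n = f.
Proof. exact: dfwithin. Qed.

Lemma in_degree_out n (f : n.-tuple R1 -> C) k : n != k ->
  @in_degree _ _ f k = fun=> 0.
Proof. exact: dfwithout. Qed.

Lemma Lambda_sqnorm_ltey n (f : n.-tuple R1 -> C) : Lambda f ->
  (Lambda_sqnorm f < +oo)%E.
Proof.
move=> [[/Lfun2P[rm r2] /Lfun2P[im i2]] _]; rewrite /Lambda_sqnorm.
under eq_integral => x _ do rewrite EFinD.
have mr : measurable_fun setT (fun x => (complex.Re (f x) ^+ 2)%:E).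
  exact/measurable_EFinP/measurable_funX.
have mi : measurable_fun setT (fun x => (complex.Im (f x) ^+ 2)%:E).
  exact/measurable_EFinP/measurable_funX.
rewrite ge0_integralD//; last 2 first.
- by move=> x _; rewrite lee_fin sqr_ge0.
- by move=> x _; rewrite lee_fin sqr_ge0.
rewrite lte_mul_pinfty ?lee_fin ?ler0n//.
by rewrite lte_add_pinfty.
Qed.

Lemma in_fock_in_degree n (f : n.-tuple R1 -> C) : Lambda f ->
  in_fock (in_degree f).
Proof.
move=> fL; have LF k : Lambda (@in_degree _ _ f k).
  have [<-|nk] := eqVneq n k; first by rewrite in_degree_in.
  by rewrite in_degree_out//; exact: Lambda0.
split=> //; rewrite (nneseries_split 0 n.+1)//; last first.
  move=> k _; rewrite mule_ge0 ?lee_fin ?ler0n// integral_ge0// => x _.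
  by rewrite lee_fin addr_ge0 ?sqr_ge0.
rewrite [X in (_ + X)%E]eseries0; last first.
  move=> k /= nk _; rewrite /Lambda_sqnorm in_degree_out; last first.
    by rewrite neq_ltn nk.
  by rewrite integral0_eq ?mule0// => x _; rewrite expr0n addr0.
rewrite adde0; apply: lte_sum_pinfty => k _; exact: Lambda_sqnorm_ltey.
Qed.

Lemma L2_inner_ae0 n (f : n.-tuple R1 -> C) : Lambda f ->
  {ae leb n, forall x, f x = 0} -> L2_inner f f = 0.
Proof.
move=> [[/Lfun2P[rm _] /Lfun2P[im _]] _] f0; rewrite /L2_inner.
have -> : (fun x => complex.Im ((f x)^* * f x)) = cst 0.
  by apply/funext => x; case: (f x) => a b /=; rewrite mulNr [b * a]mulrC subrr.
rewrite /Rintegral integral0 (ae_eq_integral (cst 0%E))//.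
- by rewrite integral0.
- apply/measurable_EFinP.
  rewrite (_ : (fun _ => _) = fun x =>
      complex.Re (f x) ^+ 2 + complex.Im (f x) ^+ 2).
    by apply: measurable_funD; exact: measurable_funX.
  by apply/funext => x; case: (f x) => a b /=; rewrite mulNr opprK -!expr2.
- by move: f0; apply: filterS => x -> _; rewrite mulr0.
Qed.

Lemma fock_inner_ae0 (F : fock R) : in_fock F ->
  fock_eq F (fun _ _ => 0) -> fock_inner F F = 0.
Proof.
move=> [FL _] F0; rewrite /fock_inner.
have inner0 n : Lambda_inner (F n) (F n) = 0.
  by rewrite /Lambda_inner L2_inner_ae0// mulr0.
under [fun N => \sum_(n < N) complex.Re _]eq_fun do
  (under eq_bigr do rewrite inner0; rewrite big1//).
under [fun N => \sum_(n < N) complex.Im _]eq_fun do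
  (under eq_bigr do rewrite inner0; rewrite big1//).
by rewrite lim_cst.
Qed.

Context (H : lmodType C) (dot : {dot H for @conjc R})
  (emb : operator R -> H) (U : H -> fock R).
Context (UC : is_unitary_extension dot emb U).

Lemma fock_eq_trans (F G K : fock R) :
  fock_eq F G -> fock_eq G K -> fock_eq F K.
Proof. by move=> FG GK n; move: (FG n) (GK n); apply: filterS2 => x -> ->. Qed.

Lemma fock_eq_sym (F G : fock R) : fock_eq F G -> fock_eq G F.
Proof. by move=> FG n; move: (FG n); apply: filterS. Qed.

Lemma unitary_lin a xi eta :
  fock_eq (U (a *: xi + eta)) (fock_lin a (U xi) (U eta)).
Proof. by case: UC. Qed.

(** Since [U] preserves inner products, [xi - eta] has norm zero as soon as its image vanishes
    almost everywhere in each degree; definiteness of [dot] concludes. *)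
Lemma unitary_inj xi eta : fock_eq (U xi) (U eta) -> xi = eta.
Proof.
move=> UE; apply/eqP; rewrite -subr_eq0; apply/negPn/negP.
move=> /(@neq0_dnorm_gt0 _ _ _ dot); have [Ufock _ Udot _ _] := UC.
rewrite -Udot fock_inner_ae0 ?ltxx//.
rewrite -scaleN1r addrC; apply: fock_eq_trans (unitary_lin _ _ _) _ => n.
move: (UE n); apply: filterS => x; rewrite /fock_lin => ->.
by rewrite mulN1r addNr.
Qed.

(** Surjectivity of [U] provides a candidate, so the choice made in [chaos] does not fall back on
    its default [0]. *)
Lemma unitary_chaos n (f : n.-tuple R1 -> C) : Lambda f ->
  fock_eq (U (chaos U f)) (in_degree f).
Proof.
move=> fL; apply: (@xgetPex _ 0 [set xi | fock_eq (U xi) (in_degree f)]).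
by have [_ _ _ Usurj _] := UC; exact/Usurj/in_fock_in_degree.
Qed.

Lemma ae_eq_in_degree n (f g : n.-tuple R1 -> C) :
  {ae leb n, forall x, f x = g x} -> fock_eq (in_degree f) (in_degree g).
Proof.
move=> fg k; have [<-|nk] := eqVneq n k; first by rewrite !in_degree_in.
by rewrite !in_degree_out//; exact: aeW.
Qed.

(** Both functions define the same set of candidates, so [xget] picks the same element, whether or
    not the functions lie in [Lambda]. *)
Lemma ae_eq_chaos n (f g : n.-tuple R1 -> C) :
  {ae leb n, forall x, f x = g x} -> chaos U f = chaos U g.
Proof.
move=> fg; congr (xget 0 _); apply/seteqP; split=> xi /= Uxi.
  exact: fock_eq_trans Uxi (ae_eq_in_degree fg).
exact: fock_eq_trans Uxi (fock_eq_sym (ae_eq_in_degree fg)).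
Qed.

Lemma chaos_lin n a (f g : n.-tuple R1 -> C) : Lambda f -> Lambda g ->
  chaos U (fun x => a * f x + g x) = a *: chaos U f + chaos U g.
Proof.
move=> fL gL; apply: unitary_inj.
apply: fock_eq_trans (unitary_chaos (Lambda_lin a fL gL)) _.
apply/fock_eq_sym/(fock_eq_trans (unitary_lin _ _ _)) => k.
have := unitary_chaos gL k; have := unitary_chaos fL k.
apply: filterS2 => x; rewrite /fock_lin => -> ->.
have [nk|nk] := eqVneq n k; last by rewrite !in_degree_out// mulr0 addr0.
by case: k / nk x => x; rewrite !in_degree_in.
Qed.

Lemma chaos0 n : chaos U (fun _ : n.-tuple R1 => 0) = 0.
Proof.
have := chaos_lin 1 (Lambda0 R n) (Lambda0 R n).
under [in LHS]eq_fun do rewrite mulr0 addr0.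
by rewrite scale1r -[LHS]addr0 => /addrI.
Qed.

Lemma chaosZ n a (f : n.-tuple R1 -> C) : Lambda f ->
  chaos U (fun x => a * f x) = a *: chaos U f.
Proof.
move=> fL; rewrite -[RHS]addr0 -(chaos0 n) -chaos_lin//; last exact: Lambda0.
by under [in RHS]eq_fun do rewrite addr0.
Qed.

Lemma unitary0 : fock_eq (U 0) (fun _ _ => 0).
Proof.
move=> k; have := unitary_lin (-1) 0 0 k; rewrite scaler0 addr0.
by apply: filterS => x; rewrite /fock_lin mulN1r addNr.
Qed.

Lemma unitary_sum_chaos N (v : fock R) :
  (forall n, (n < N)%N -> Lambda (v n)) ->
  fock_eq (U (\sum_(n < N) chaos U (v n)))
    (fun n x => if (n < N)%N then v n x else 0).
Proof.
elim: N => [|N IHN] vL; first by rewrite big_ord0; exact: unitary0.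
have {}IHN := IHN (fun n nN => vL n (ltnW nN)).
rewrite big_ord_recr/= addrC -[chaos U _]scale1r.
apply: fock_eq_trans (unitary_lin _ _ _) _ => n.
move: (IHN n) (unitary_chaos (vL N (ltnSn N)) n).
apply: filterS2 => x; rewrite /fock_lin mul1r => -> ->.
have [nN|nN] := eqVneq N n.
  by case: n / nN x => x; rewrite in_degree_in ltnn ltnSn addr0.
by rewrite in_degree_out// add0r ltnS [in RHS]leq_eqVlt eq_sym (negbTE nN).
Qed.

(** Uniqueness of the chaos expansion. Padding by zero from degree [N] on covers the case [N <= q]
    too, where it forces [f] to vanish almost everywhere. *)
Lemma sum_chaos_eq N (v : fock R) q (f : q.-tuple R1 -> C) :
  (forall n, (n < N)%N -> Lambda (v n)) -> Lambda f ->
  \sum_(n < N) chaos U (v n) = chaos U f ->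
  fock_eq (fun n x => if (n < N)%N then v n x else 0) (in_degree f).
Proof.
move=> vL fL vf; apply: fock_eq_trans (unitary_chaos fL).
by rewrite -vf; exact/fock_eq_sym/unitary_sum_chaos.
Qed.

Lemma chaos_derivative0 n t :
  chaos_derivative U (fun _ : n.-tuple R1 => 0) t = 0.
Proof. by case: n => [|n] //=; rewrite /slice chaos0 scaler0. Qed.

Lemma ae_eq_chaos_derivative n (f g : n.-tuple R1 -> C) :
  {ae leb n, forall x, f x = g x} ->
  {ae leb1, forall t, chaos_derivative U f t = chaos_derivative U g t}.
Proof.
case: n f g => [|n] f g; first by move=> _; exact: aeW.
move=> /ae_cons; apply: filterS => t fg /=; congr (_ *: _).
exact: ae_eq_chaos.
Qed.

Lemma derivative_chaos q (f : q.-tuple R1 -> C) : Lambda f ->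
  {ae leb1, forall t, derivative U (chaos U f) t = chaos_derivative U f t}.
Proof.
move=> fL; rewrite /derivative.
case: xgetP => [Phi _ [N [v [vL fv ->]]]|none]; last first.
  (* A representation exists: [f] alone in degree [q], with cutoff [q.+1] so that this degree is
     included. *)
  exfalso; apply: (none (fun t =>
    \sum_(n < q.+1) chaos_derivative U (@in_degree R _ f n) t)).
  exists q.+1, (in_degree f); split=> //.
    by move=> n _; case: (in_fock_in_degree fL).
  rewrite (sum_dfwith (G := @chaos R H U)) ?ltnSn//.
  by move=> k; exact: chaos0.
have vf := sum_chaos_eq vL fL (esym fv).
have : {ae leb1, forall t, forall n : 'I_N,
    chaos_derivative U (v n) t = chaos_derivative U (@in_degree R _ f n) t}.
  apply: filter_forall => n; apply: ae_eq_chaos_derivative.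
  by have := vf n; rewrite ltn_ord.
(* If the chosen cutoff misses degree [q], then [f] is zero almost everywhere and so is its
   derivative. *)
have : {ae leb1, forall t,
    (if (q < N)%N then chaos_derivative U f t else 0) = chaos_derivative U f t}.
  case: (boolP (q < N)%N) => qN; first exact: aeW.
  have := vf q; rewrite (negbTE qN) in_degree_in => /ae_eq_chaos_derivative.
  by apply: filterS => t <-; rewrite chaos_derivative0.
apply: filterS2 => t <- fvt; rewrite (eq_bigr _ (fun n _ => fvt n)).
rewrite (sum_dfwith
  (G := fun n (g : n.-tuple R1 -> C) => chaos_derivative U g t))//.
by move=> k; exact: chaos_derivative0.
Qed.

Lemma divergence_kernel q (k : q.+1.-tuple R1 -> C) (eta : R1 -> H) :
  square_integrable (leb q.+1) k ->
  {ae leb1, forall t, Lambda (slice k t)} ->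
  {ae leb1, forall t, eta t = chaos U (slice k t)} ->
  divergence U eta = chaos U (antisymmetrize k).
Proof.
move=> k2 kL etak; rewrite /divergence.
pose z n (_ : n.+1.-tuple R1) : C := 0.
have z2 n : square_integrable (leb n.+1) (dfwith z q k n).
  by case: (@dfwithP _ _ z _ k n) => // *; exact: square_integrable0.
case: xgetP => [zeta _ [N [w [w2 wL etaw ->]]]|none]; last first.
  exfalso; apply: (none (chaos U (antisymmetrize k))).
  exists q.+1, (dfwith z q k); split=> //.
  - move=> n _; case: (@dfwithP _ _ z _ k n) => // m _.
    by apply: aeW => t; exact: Lambda0.
  - move: etak; apply: filterS => t ->.
    rewrite (sum_dfwith (G := fun n (g : n.+1.-tuple R1 -> C) =>
      chaos U (slice g t))) ?ltnSn//.
    by move=> n; exact: chaos0.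
  - rewrite (sum_dfwith (G := fun n (g : n.+1.-tuple R1 -> C) =>
      chaos U (antisymmetrize g))) ?ltnSn//.
    by move=> n; rewrite antisymmetrize0 chaos0.
(* For almost every [t] both expansions represent [eta t], so uniqueness identifies the slices at
   [t] of the chosen kernels with those of [k]. *)
have wk : {ae leb1, forall t, fock_eq
    (fun n x => if (n < N)%N then slice (w n) t x else 0)
    (in_degree (slice k t))}.
  have wLI : {ae leb1, forall t, forall n : 'I_N, Lambda (slice (w n) t)}.
    by apply: filter_forall => n; exact: wL.
  near=> t; have kLt : Lambda (slice k t) by near: t.
  apply: (@sum_chaos_eq N (fun n => slice (w n) t)) => //.
    move=> n nN; have wLt : forall n : 'I_N, Lambda (slice (w n) t) by near: t.
    exact: (wLt (Ordinal nN)).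
  have <- : eta t = chaos U (slice k t) by near: t.
  by apply/esym; near: t.
have slice_z t n : slice (dfwith z q k n) t = @in_degree _ _ (slice k t) n.
  have [<-|qn] := eqVneq q n; first by rewrite dfwithin in_degree_in.
  by rewrite dfwithout// in_degree_out.
(* Equality of almost all slices gives equality almost everywhere of the kernels, which
   antisymmetrization and [chaos] both respect. *)
have wz (n : 'I_N) : chaos U (antisymmetrize (w n)) =
    chaos U (antisymmetrize (dfwith z q k n)).
  apply/ae_eq_chaos/ae_eq_antisymmetrize/ae_slice_inj => //; first exact: w2.
  move: wk; apply: filterS => t /(_ n); rewrite ltn_ord slice_z.
  exact.
rewrite (eq_bigr _ (fun n _ => wz n)).
rewrite (sum_dfwith (G := fun n (g : n.+1.-tuple R1 -> C) =>
  chaos U (antisymmetrize g))); last first.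
  by move=> n; rewrite antisymmetrize0 chaos0.
(* If the chosen cutoff misses degree [q], almost every slice of [k] vanishes, so [k] is zero almost
   everywhere and its chaos is [0]. *)
case: ifPn => // qN; rewrite -[LHS](chaos0 q.+1) -antisymmetrize0.
apply/ae_eq_chaos/ae_eq_antisymmetrize/ae_slice_inj => //.
  exact: square_integrable0.
by move: wk; apply: filterS => t /(_ q); rewrite (negbTE qN) in_degree_in.
Unshelve. all: by end_near. Qed.

Lemma LambdaZ n a (f : n.-tuple R1 -> C) : Lambda f ->
  Lambda (fun x => a * f x).
Proof.
move=> fL; rewrite (_ : (fun _ => _) = fun x => a * f x + 0).
  exact: Lambda_lin fL (Lambda0 R n).
by apply/funext => x; rewrite addr0.
Qed.

Lemma slice_tensor n (h : R1 -> C) (f : n.-tuple R1 -> C) t :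
  slice (tensor h f) t = fun x => h t * f x.
Proof.
apply/funext => x; rewrite /slice /tensor theadE; congr (_ * f _).
exact: val_inj.
Qed.

Lemma divergence_simple_process p (h : R1 -> C) (f : p.-tuple R1 -> C) :
  square_integrable leb1 h -> Lambda f ->
  divergence U (simple_process h (chaos U f)) =
  chaos U (antisymmetrize (tensor h f)).
Proof.
move=> h2 fL; apply: divergence_kernel.
- by apply: square_integrable_tensor => //; case: fL.
- by apply: aeW => t; rewrite slice_tensor; exact: LambdaZ.
- by apply: aeW => t; rewrite slice_tensor chaosZ.
Qed.

Lemma antisymmetrize_tensorZ p a (h : R1 -> C) (f : p.-tuple R1 -> C) :
  antisymmetrize (tensor h (fun x => a * f x)) =
  fun x => a * antisymmetrize (tensor h f) x.
Proof.
apply/funext => x; rewrite /antisymmetrize mulrCA; congr (_ * _).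
rewrite mulr_sumr; apply: eq_bigr => s _.
by rewrite /tensor [h _ * (a * _)]mulrCA [LHS]mulrCA.
Qed.

(** With the sign rule valid at every point, the kernels of the two sides agree pointwise. Null sets
    of [t] enter only through [derivative] and through the membership of slices in [Lambda]. *)
Lemma anticommutator_strict p (h : R1 -> C) (f : p.-tuple R1 -> C) :
  square_integrable leb1 h -> Lambda f -> strictly_antisymmetric f ->
  {ae leb1, forall t,
    derivative U (divergence U (simple_process h (chaos U f))) t +
    divergence U (simple_process h (derivative U (chaos U f) t)) =
    h t *: chaos U f}.
Proof.
move=> h2 fL fS; rewrite divergence_simple_process//.
set g := antisymmetrize (tensor h f).
have gL : Lambda g.
  by apply/Lambda_antisymmetrize/square_integrable_tensor => //; case: fL.
have gLt := ae_Lambda_slice gL.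
have Dg := derivative_chaos gL; have Df := derivative_chaos fL.
case: p f fL fS @g gL gLt Dg Df => [|p] f fL fS g gL gLt Dg Df.
  move: Df gLt Dg; apply: filterS3 => t -> gt -> /=.
  (* In degree zero the derivative is [0]; writing it as the chaos of the zero kernel brings the
     process into the form whose divergence is known. *)
  rewrite -[X in simple_process h X](chaos0 0).
  rewrite divergence_simple_process//; last exact: Lambda0.
  rewrite (_ : tensor h _ = fun=> 0) ?antisymmetrize0; last first.
    by apply/funext => x; rewrite /tensor mulr0.
  rewrite chaos0 addr0 scale1r -chaosZ//; congr (chaos U _).
  by apply/funext => y; exact: antisymmetrize_tensor_cons0.
have fLt := ae_Lambda_slice fL.
near=> t.
have -> : derivative U (chaos U g) t = chaos_derivative U g t by near: t.
have -> : derivative U (chaos U f) t = chaos_derivative U f t by near: t.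
have ftL : Lambda (slice f t) by near: t.
have gtL : Lambda (slice g t) by near: t.
(* The factor [p.+1] of the derivative moves into the kernel, so that the process is again [h] times
   a single chaos. *)
rewrite /= -[_ *: chaos U (slice f t)]chaosZ//.
rewrite divergence_simple_process//; last exact: LambdaZ.
rewrite antisymmetrize_tensorZ -chaos_lin//; last first.
  apply/LambdaZ/Lambda_antisymmetrize/square_integrable_tensor => //.
  by case: ftL.
rewrite -chaosZ//; congr (chaos U _); apply/funext => y.
exact: antisymmetrize_tensor_cons.
Unshelve. all: by end_near. Qed.

End Fock.

Theorem proposition4p5 (R : realType) (H : lmodType R[i])
    (dot : {dot H for @conjc R}) (emb : operator R -> H) (U : H -> fock R)
    (L2C : is_L2_Clifford dot emb) (UC : is_unitary_extension dot emb U)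
    (p : nat) (h : measurableTypeR R -> R[i])
    (hL2 : square_integrable (@lebesgue_half R) h)
    (f : p.-tuple (measurableTypeR R) -> R[i]) (fL : Lambda f) :
  {ae @lebesgue_half R, forall t,
    derivative U (divergence U (simple_process h (chaos U f))) t +
    divergence U (simple_process h (derivative U (chaos U f) t)) =
    h t *: chaos U f}.
Proof.
(* The claim involves [f] only through its chaos, so [f] may be replaced by its antisymmetrization,
   which obeys the sign rule everywhere. *)
rewrite (ae_eq_chaos U (ae_antisymmetrize_id fL)).
have f2 : square_integrable (lebesgue_half_power R p) f by case: fL.
apply: (anticommutator_strict UC hL2 (Lambda_antisymmetrize f2)).
exact: antisymmetrize_strict.
Qed.
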